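(* Let $q\ge 2$ be a prime power and $N\ge 1$ an integer. Fix a polynomial $A\in\mathcal{M}_N$. For any integers $0\le h\le N-1$ and $1\le z\le (h+1)/2$, $$\big|\{F\in\mathcal{M}_N:\ \deg(F-A)\le h,\ P^-(F)>z\}\big|\ \le\ \frac{q^{h+1}}{z\,(1-1/q)}.$$
   Context: $\mathcal{M}_N$ is the set of monic polynomials of degree $N$ in $\mathbb{F}_q[t]$, and $P^-(F):=\min\{\deg P: P\mid F,\ P\text{ monic irreducible}\}$. The zero polynomial is regarded as having degree $\le h$ for every $h$. *)

(* Defs.v *)
From mathcomp Require Import all_boot all_order all_algebra.

Set Implicit Arguments.
Unset Strict Implicit.
Unset Printing Implicit Defensive.

Import Order.TTheory GRing.Theory Num.Theory.
Local Open Scope ring_scope.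

Definition monic_of_degree (K : finFieldType) (N : nat) (F : {poly K}) : bool :=
  (F \is monic) && (size F == N.+1).

(* [irreducibleb] decides the library's [irreducible_poly] over a finite
   integral domain (lemma [irreducibleP]). *)
Definition monic_irreducible_divisor (K : finFieldType) (F P : {poly K}) : bool :=
  [&& P \is monic, irreducibleb P & P %| F].

(* P^-(F). If F != 0, every divisor of F has degree < size F, so it lies in
   {poly_(size F) K} and the default value [size F] never competes with an
   actual divisor; the minimum is genuine as soon as F is nonconstant (see
   [PminusP]). On constants, which have no irreducible divisor or are zero,
   the value is junk. *)
Definition Pminus (K : finFieldType) (F : {poly K}) : nat :=
  \big[minn/size F]_(P : {poly_(size F) K} | monic_irreducible_divisor F P)
    (size P).-1.

Lemma Pminus_le (K : finFieldType) (F P : {poly K}) :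
  F != 0 -> P \is monic -> irreducible_poly P -> P %| F ->
  (Pminus F <= (size P).-1)%N.
Proof.
move=> F0 Pm Pirr PF; have sP := dvdp_leq F0 PF.
have eP : npolyp (size F) P = P :> {poly K} by rewrite npolypK.
rewrite -[P in X in (_ <= X)%N]eP /Pminus.
apply: (@bigmin_le_cond _ nat _ (size F) (npolyp (size F) P)
  (fun Q : {poly_(size F) K} => monic_irreducible_divisor F Q) (fun Q : {poly_(size F) K} => (size Q).-1)).
rewrite /monic_irreducible_divisor eP Pm PF andbT /=.
exact/irreducibleP.
Qed.

Lemma exists_monic_irreducible_divisor (K : finFieldType) (F : {poly K}) :
  (1 < size F)%N ->
  exists P : {poly K}, [/\ P \is monic, irreducible_poly P & P %| F].
Proof.
have [n] := ubnP (size F); elim: n F => // n IH F /ltnSE leF F1.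
have F0 : F != 0 by rewrite -size_poly_gt0 (ltn_trans _ F1).
have [irr|] := boolP (irreducibleb F).
  have/irreducibleP/= irrF := irr.
  exists ((lead_coef F)^-1 *: F).
  have c0 : (lead_coef F)^-1 != 0 by rewrite invr_eq0 lead_coef_eq0.
  split.
  - by rewrite monicE lead_coefZ mulVf // lead_coef_eq0.
  - split=> [|p p1 pF]; first by rewrite size_scale.
    rewrite dvdpZr // in pF.
    by rewrite (eqp_trans (irrF.2 p p1 pF)) // eqp_sym eqp_scale.
  - by rewrite dvdpZl.
move=> /irreducibleP/= nirr.
have [q] : exists q : {poly_(size F) K},
    [&& (q : {poly K}) %| F, size q != 1%N & ~~ ((q : {poly K}) %= F)].
  apply/existsP; apply: contra_notT nirr => /existsPn nq; split=> // p p1 pF.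
  have := nq (npolyp (size F) p); rewrite npolypK; last exact: dvdp_leq.
  by rewrite pF p1 /= negbK.
case/and3P => qF q1 nqF.
have q0 : (q : {poly K}) != 0.
  by apply: contraNneq F0 => q0; move: qF; rewrite q0 dvd0p.
have sq : (size q < size F)%N.
  by rewrite ltn_neqAle dvdp_leq // andbT dvdp_size_eqp.
have [||P [Pm Pi Pq]] := IH q.
- exact: leq_trans sq leF.
- by rewrite ltn_neqAle eq_sym q1 size_poly_gt0.
by exists P; split=> //; apply: dvdp_trans qF.
Qed.

Lemma PminusP (K : finFieldType) (F : {poly K}) : (1 < size F)%N ->
  exists P : {poly K},
    [/\ P \is monic, irreducible_poly P, P %| F & (size P).-1 = Pminus F].
Proof.
move=> F1; have F0 : F != 0 by rewrite -size_poly_gt0 (ltn_trans _ F1).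
suff [eF|//] : Pminus F = size F \/ exists P : {poly K},
    [/\ P \is monic, irreducible_poly P, P %| F & (size P).-1 = Pminus F].
  have [P [Pm Pi PF]] := exists_monic_irreducible_divisor F1.
  have := Pminus_le F0 Pm Pi PF; rewrite eF => leFP; have := leq_trans (dvdp_leq F0 PF) leFP.
  by case: (size P) Pi.1 => // k _; rewrite ltnn.
rewrite /Pminus; apply: (big_rec (fun m => m = size F \/ exists P : {poly K},
    [/\ P \is monic, irreducible_poly P, P %| F & (size P).-1 = m])).
  by left.
move=> P m /and3P[Pm /irreducibleP Pi PF] H; rewrite /minn.
by case: ifP => // _; right; exists P.
Qed.

(* Main.v *)
(* Selberg's sieve: weights supported on divisors of degree at most z bound
   the number of unsifted F by q^(h+1) / S, where S is the sum of 1/|D| over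
   the squarefree monic D of degree at most z. There is no error term, because
   2 z <= h + 1 makes divisibility by distinct primes exactly independent on
   the interval around A. Writing every monic polynomial as a square times a
   squarefree one gives z + 1 <= S * (\sum_k q^(-k)), so S >= (z+1)(1 - 1/q).
   Squarefree polynomials are encoded as sets of primes. *)

Require Import Defs.
From mathcomp Require Import all_boot all_order all_algebra.
From mathcomp Require Import ring zify.

Set Implicit Arguments.
Unset Strict Implicit.
Unset Printing Implicit Defensive.

Import Order.TTheory GRing.Theory Num.Theory.
Local Open Scope ring_scope.

(** * The norm of a polynomial and its multiplicativity *)

(** This is |p| = q^(deg p), with the default value 1 at [p = 0], so it is positive everywhere. *)
Definition pnorm (K : finFieldType) (p : {poly K}) : rat :=
  #|K|%:R ^+ (size p).-1.

Lemma pnorm_gt0 (K : finFieldType) (p : {poly K}) : 0 < pnorm p.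
Proof. by rewrite exprn_gt0 // ltr0n; apply/card_gt0P; exists 0. Qed.

Lemma pnorm1 (K : finFieldType) : pnorm (1 : {poly K}) = 1.
Proof. by rewrite /pnorm size_poly1. Qed.

Lemma size_mul_succ (K : finFieldType) (p r : {poly K}) :
  p != 0 -> r != 0 -> size (p * r) = ((size p).-1 + (size r).-1).+1.
Proof.
move=> p0 r0; rewrite size_mul //.
by rewrite (polySpred p0) (polySpred r0) /= addnS.
Qed.

Lemma pnormM (K : finFieldType) (p r : {poly K}) :
  p != 0 -> r != 0 -> pnorm (p * r) = pnorm p * pnorm r.
Proof.
by move=> p0 r0; rewrite /pnorm size_mul_succ // exprD.
Qed.

Lemma pnorm_prod (K : finFieldType) (I : finType) (p : I -> {poly K})
    (T : {set I}) :
  (forall i, i \in T -> p i \is monic) ->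
  pnorm (\prod_(i in T) p i) = \prod_(i in T) pnorm (p i).
Proof.
move=> mp.
suff [] : pnorm (\prod_(i in T) p i) = \prod_(i in T) pnorm (p i)
  /\ \prod_(i in T) p i != 0 by [].
apply: (big_ind2 (fun (u : {poly K}) (v : rat) => pnorm u = v /\ u != 0)).
- by rewrite pnorm1 oner_neq0.
- move=> u _ v _ [<- u0] [<- v0]; split; last by rewrite mulf_neq0.
  exact: pnormM.
- by move=> i /mp /monic_neq0.
Qed.

(** * Equidistribution and independence of divisibility on an interval around [A] *)

(** The solutions are exactly [G = D * Q - A %% D] with [Q] of size at most [n - deg D]. The bound
    on deg [D] keeps the remainder within size [n], so the count is exact. *)
Lemma card_dvdp_shift (K : finFieldType) (A D : {poly K}) (n : nat) :
  D \is monic -> ((size D).-1 <= n)%N ->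
  (#|[set G : {poly_n K} | D %| A + (G : {poly K})]|%:R : rat)
  = #|K|%:R ^+ n / pnorm D.
Proof.
move=> mD leDn; have D0 := monic_neq0 mD.
have sD : (0 < size D)%N by rewrite size_poly_gt0.
set m := (n - (size D).-1)%N.
pose f (Q : {poly_m K}) : {poly_n K} := npolyp n (D * (Q : {poly K}) - A %% D).
have sA : (size (A %% D)%R <= n)%N.
  by rewrite (leq_trans _ leDn) // -ltnS prednK // ltn_modpN0.
have fE Q : f Q = D * (Q : {poly K}) - A %% D :> {poly K}.
  rewrite /f npolypK //; apply: leq_trans (size_polyD _ _) _.
  rewrite size_polyN geq_max sA andbT.
  have [->|Q0] := eqVneq (Q : {poly K}) 0; first by rewrite mulr0 size_poly0.
  rewrite size_mul_succ //.
  have sQ : (size (Q : {poly K}) <= m)%N := size_npoly Q.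
  have Q1 : (0 < size (Q : {poly K}))%N by rewrite size_poly_gt0.
  move: Q1 sQ; rewrite /m; lia.
have f_inj : injective f.
  move=> Q1 Q2 /(congr1 (fun G : {poly_n K} => (G : {poly K}))).
  by rewrite !fE => /addIr /(mulfI D0) /val_inj.
have -> : [set G : {poly_n K} | D %| A + (G : {poly K})] = f @: setT.
  apply/setP => G; rewrite inE; apply/idP/imsetP => [DG|[Q _ ->]]; last first.
    rewrite fE {1}(divp_eq A D) addrCA addrK.
    by apply: dvdp_add; [exact: dvdp_mulr | exact: dvdp_mull].
  have {}DG : D %| (G : {poly K}) + A %% D.
    move: DG; rewrite {1}(divp_eq A D) -addrA dvdp_addr ?dvdp_mull //.
    by rewrite addrC.
  have [Q eQ] : exists Q, (G : {poly K}) + A %% D = D * Q.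
    by exists (((G : {poly K}) + A %% D) %/ D); rewrite mulrC divpK.
  have sQ : (size Q <= m)%N.
    have [->|Q0] := eqVneq Q 0; first by rewrite size_poly0.
    have : (size (D * Q)%R <= n)%N.
      by rewrite -eQ (leq_trans (size_polyD _ _)) // geq_max size_npoly.
    have Q1 : (0 < size Q)%N by rewrite size_poly_gt0.
    by move: Q1; rewrite size_mul_succ // /m; lia.
  exists (npolyp m Q) => //; apply/val_inj/esym; rewrite [LHS]fE npolypK //.
  by rewrite -eQ addrK.
rewrite card_imset // cardsT card_npoly natrX /m /pnorm.
by rewrite exprB // unitfE pnatr_eq0 -lt0n ltnW // card_finNzRing_gt1.
Qed.

(* The events [p i %| A + G] are independent for [G] uniform among the
   polynomials of size at most [n]; the extra divisor [D] makes the
   induction on [s] go through. *)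
Lemma sum_dvdp_prod (K : finFieldType) (I : eqType) (p : I -> {poly K})
    (A : {poly K}) (n : nat) (a b : I -> rat) (s : seq I) (D : {poly K}) :
  uniq s -> {in s, forall i, p i \is monic} ->
  {in s &, forall i j, i != j -> coprimep (p i) (p j)} ->
  D \is monic -> {in s, forall i, coprimep D (p i)} ->
  ((size D).-1 + \sum_(i <- s) (size (p i)).-1 <= n)%N ->
  \sum_(G : {poly_n K}) ((D %| A + (G : {poly K}))%R)%:R *
      \prod_(i <- s) (a i + b i * ((p i %| A + (G : {poly K}))%R)%:R)
  = #|K|%:R ^+ n / pnorm D * \prod_(i <- s) (a i + b i / pnorm (p i)).
Proof.
elim: s D => [|i s IH] D.
  move=> _ _ _ mD _; rewrite big_nil addn0 => sD; rewrite big_nil mulr1.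
  rewrite -(card_dvdp_shift A mD) // -sum1dep_card natr_sum [RHS]big_mkcond /=.
  by apply: eq_bigr => G _; rewrite big_nil mulr1; case: ifP.
case/andP => is_s us mp cop mD cD.
rewrite big_cons => sz.
have iin : i \in i :: s by rewrite mem_head.
have sub : {subset s <= i :: s} by move=> j js; rewrite in_cons js orbT.
have mp' : {in s, forall i, p i \is monic} by move=> j /sub /mp.
have cop' : {in s &, forall i j, i != j -> coprimep (p i) (p j)}.
  by move=> j k /sub js /sub ks; apply: cop.
have D0 := monic_neq0 mD; have p0 := monic_neq0 (mp i iin).
have sDp : size (D * p i) = ((size D).-1 + (size (p i)).-1).+1.
  exact: size_mul_succ.
have sD : (0 < size D)%N by rewrite size_poly_gt0.
have sp : (0 < size (p i))%N by rewrite size_poly_gt0.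
(* Expanding the factor at [i] gives two sums: the [a i] term keeps the divisor [D], and the [b i]
   term has divisor [D * p i], by coprimality of [D] and [p i]. *)
have E1 := IH D us mp' cop' mD (fun j js => cD j (sub j js)).
have E2 : \sum_(G : {poly_n K}) ((D * p i %| A + (G : {poly K}))%R)%:R *
      \prod_(i <- s) (a i + b i * ((p i %| A + (G : {poly K}))%R)%:R)
  = #|K|%:R ^+ n / pnorm (D * p i) * \prod_(i <- s) (a i + b i / pnorm (p i)).
  apply: IH => //.
  - by rewrite monicMl // mp.
  - move=> j js; rewrite coprimepMl (cD j (sub j js)) cop //; first exact: sub.
    by apply: contraNneq is_s => ->.
  - by rewrite sDp; lia.
rewrite big_cons.
have -> : #|K|%:R ^+ n / pnorm D *
    ((a i + b i / pnorm (p i)) * \prod_(j <- s) (a j + b j / pnorm (p j)))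
  = a i * (#|K|%:R ^+ n / pnorm D * \prod_(j <- s) (a j + b j / pnorm (p j)))
  + b i * (#|K|%:R ^+ n / pnorm (D * p i)
           * \prod_(j <- s) (a j + b j / pnorm (p j))).
  rewrite pnormM //; have := pnorm_gt0 D; have := pnorm_gt0 (p i).
  move: (pnorm D) (pnorm (p i)) => x y /lt0r_neq0 y0 /lt0r_neq0 x0.
  by field; rewrite x0 y0.
rewrite -E1; last by lia.
rewrite -E2 !mulr_sumr -big_split /=; apply: eq_bigr => G _.
rewrite big_cons Gauss_dvdp; last exact: cD.
by case: (D %| _); case: (p i %| _) => /=; ring.
Qed.

Lemma sum_dvdp_prod_set (K : finFieldType) (I : finType) (p : I -> {poly K})
    (A : {poly K}) (n : nat) (a b : I -> rat) (T : {set I}) :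
  (forall i, p i \is monic) ->
  (forall i j, i != j -> coprimep (p i) (p j)) ->
  (\sum_(i in T) (size (p i)).-1 <= n)%N ->
  \sum_(G : {poly_n K})
      \prod_(i in T) (a i + b i * ((p i %| A + (G : {poly K}))%R)%:R)
  = #|K|%:R ^+ n * \prod_(i in T) (a i + b i / pnorm (p i)).
Proof.
move=> mp cop sT.
have := @sum_dvdp_prod K I p A n a b (enum T) 1.
rewrite enum_uniq monic1 size_poly1 add0n pnorm1 divr1 !big_enum /= => <- //.
- apply: eq_bigr => G _; rewrite dvd1p mul1r.
  by rewrite [RHS]big_enum.
- by move=> i j _ _; apply: cop.
- by move=> i _; rewrite coprime1p.
Qed.

(** * Orthogonal functions and the sieve bound *)

(** For distinct monic primes [p i] this is, up to the sign (-1)^|T|, the Ramanujan sum of modulus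
    the product over [T]. *)
Definition psi (K : finFieldType) (I : finType) (p : I -> {poly K})
    (T : {set I}) (F : {poly K}) : rat :=
  \prod_(i in T) (1 - pnorm (p i) * ((p i %| F)%R)%:R).

(** Independence turns the sum into a product of means over [T1 :|: T2]. An index in just one set
    has mean 1 - |p|/|p| = 0; an index in both has mean 1 - 2 + |p| = |p| - 1. *)
Lemma psi_orthogonal (K : finFieldType) (I : finType) (p : I -> {poly K})
    (A : {poly K}) (n : nat) (T1 T2 : {set I}) :
  (forall i, p i \is monic) ->
  (forall i j, i != j -> coprimep (p i) (p j)) ->
  (\sum_(i in T1 :|: T2) (size (p i)).-1 <= n)%N ->
  \sum_(G : {poly_n K}) psi p T1 (A + (G : {poly K})) * psi p T2 (A + (G : {poly K}))
  = if T1 == T2 then #|K|%:R ^+ n * \prod_(i in T1) (pnorm (p i) - 1) else 0.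
Proof.
move=> mp cop sT.
(* For an indicator e, (1 - x e)^2 = 1 + (x^2 - 2x) e because e^2 = e. *)
pose b i := if i \in T1 :&: T2 then pnorm (p i) ^+ 2 - pnorm (p i) *+ 2
            else - pnorm (p i).
transitivity (\sum_(G : {poly_n K}) \prod_(i in T1 :|: T2)
    (1 + b i * ((p i %| A + (G : {poly K}))%R)%:R)).
  apply: eq_bigr => G _; rewrite /psi.
  rewrite big_mkcond [X in _ * X]big_mkcond -big_split [RHS]big_mkcond /=.
  apply: eq_bigr => i _; rewrite /b !inE.
  by case: (i \in T1); case: (i \in T2); case: (p i %| _) => /=; ring.
rewrite (sum_dvdp_prod_set A (fun=> 1) b mp cop sT).
have [eqT|neq] := eqVneq T1 T2.
  rewrite -eqT setUid; congr (_ * _); apply: eq_bigr => i iT.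
  rewrite /b -eqT setIid iT; have /lt0r_neq0 := pnorm_gt0 (p i).
  by move: (pnorm _) => x x0; field.
suff [i iU iI] : exists2 i, i \in T1 :|: T2 & i \notin T1 :&: T2.
  rewrite (bigD1 i) //= /b (negbTE iI) mulNr divff ?subrr ?mul0r ?mulr0 //.
  exact/lt0r_neq0/pnorm_gt0.
apply/exists_inP; apply: contra_neqT neq => /exists_inPn H.
apply/setP => i; have := H i; rewrite !inE negbK.
by case: (i \in T1); case: (i \in T2) => // /(_ isT).
Qed.

(* The sieve weight is [w F = \sum_T psi p T F / |T|], with |T| the norm of
   the product over [T]; it equals [S = \sum_T 1 / |T|] on unsifted [F], and
   orthogonality bounds its second moment by [q ^ n * S]. *)
Lemma selberg_upper_bound (K : finFieldType) (I : finType) (p : I -> {poly K})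
    (A : {poly K}) (n : nat) (TT : {set {set I}}) :
  (forall i, p i \is monic) ->
  (forall i j, i != j -> coprimep (p i) (p j)) ->
  {in TT &, forall T1 T2,
     (\sum_(i in T1 :|: T2) (size (p i)).-1 <= n)%N} ->
  #|[set G : {poly_n K} | [forall i, ~~ (p i %| A + (G : {poly K}))%R]]|%:R
    * \sum_(T in TT) (pnorm (\prod_(i in T) p i))^-1
  <= #|K|%:R ^+ n.
Proof.
move=> mp cop sTT; set R := [set G | _]; set S := \sum_(T in TT) _.
pose x (T : {set I}) := (pnorm (\prod_(i in T) p i))^-1.
pose w F := \sum_(T in TT) x T * psi p T F.
have x_gt0 T : 0 < x T by rewrite invr_gt0 pnorm_gt0.
have S_ge0 : 0 <= S by apply: sumr_ge0 => T _; exact: (ltW (x_gt0 T)).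
have wR (G : {poly_n K}) : G \in R -> w (A + (G : {poly K})) = S.
  rewrite inE => /forallP rough; apply: eq_bigr => T _.
  rewrite /psi big1 ?mulr1 // => i _.
  by rewrite (negbTE (rough i)) mulr0 subr0.
have lower : #|R|%:R * S ^+ 2
    <= \sum_(G : {poly_n K}) w (A + (G : {poly K})) ^+ 2.
  rewrite (bigID (mem R)) /= mulr_natl -sumr_const.
  rewrite (eq_bigr (fun G : {poly_n K} => w (A + (G : {poly K})) ^+ 2)).
    by rewrite lerDl sumr_ge0 // => G _; rewrite sqr_ge0.
  by move=> G /wR ->.
have upper : \sum_(G : {poly_n K}) w (A + (G : {poly K})) ^+ 2
    <= #|K|%:R ^+ n * S.
  have -> : \sum_(G : {poly_n K}) w (A + (G : {poly K})) ^+ 2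
    = \sum_(T in TT) x T ^+ 2
        * (#|K|%:R ^+ n * \prod_(i in T) (pnorm (p i) - 1)).
    transitivity (\sum_(T1 in TT) \sum_(T2 in TT) x T1 * x T2 *
       \sum_(G : {poly_n K})
         psi p T1 (A + (G : {poly K})) * psi p T2 (A + (G : {poly K}))).
      under eq_bigr => G _.
        rewrite expr2 big_distrlr /=; over.
      rewrite exchange_big; apply: eq_bigr => T1 _.
      rewrite exchange_big; apply: eq_bigr => T2 _.
      by rewrite mulr_sumr; apply: eq_bigr => G _; rewrite mulrACA.
    apply: eq_bigr => T1 T1in; rewrite (bigD1 T1) //=.
    rewrite psi_orthogonal ?sTT // eqxx -expr2 [X in _ + X]big1 ?addr0 // => T2.
    by case/andP => T2in ne; rewrite psi_orthogonal ?sTT // eq_sym (negbTE ne) mulr0.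
  (* Only diagonal terms remain; one factor [x T] cancels against the product of the |p| - 1, which
     is at most the product of the |p|, that is 1 / [x T]. *)
  rewrite mulr_sumr; apply: ler_sum => T _.
  rewrite mulrCA ler_wpM2l ?exprn_ge0 ?ler0n //.
  rewrite expr2 -mulrA -[leRHS]mulr1 ler_wpM2l ?(ltW (x_gt0 T)) //.
  rewrite /x ler_pdivrMl ?pnorm_gt0 // mulr1 pnorm_prod //.
  apply: ler_prod => i _; rewrite lerBlDr lerDl ler01 andbT subr_ge0.
  by rewrite exprn_ege1 // ler1n ltnW // card_finNzRing_gt1.
have [->|S0] := eqVneq S 0; first by rewrite mulr0 exprn_ge0 // ler0n.
have S_gt0 : 0 < S by rewrite lt0r S0.
by rewrite -(ler_pM2r S_gt0) -mulrA -expr2 (le_trans lower).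
Qed.

(** * Sums over monic polynomials *)

Lemma card_monic_size (K : finFieldType) (m k : nat) : (k < m)%N ->
  #|[set F : {poly_m K} | ((F : {poly K}) \is monic)
                          && (size (F : {poly K}) == k.+1)]| = (#|K| ^ k)%N.
Proof.
move=> km; pose f (G : {poly_k K}) : {poly_m K} := npolyp m ('X^k + (G : {poly K})).
have sG (G : {poly_k K}) : (size (G : {poly K}) < size ('X^k : {poly K}))%N.
  by rewrite size_polyXn ltnS size_npoly.
have fE G : f G = 'X^k + (G : {poly K}) :> {poly K}.
  by rewrite /f npolypK // size_polyDl // size_polyXn.
have f_inj : injective f.
  move=> G1 G2 /(congr1 (fun G : {poly_m K} => (G : {poly K}))).
  by rewrite !fE => /addrI /val_inj.
rewrite -card_npoly -cardsT -(card_imset _ f_inj); apply: eq_card => F.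
rewrite inE; apply/andP/imsetP => [[mF /eqP sF]|[G _ ->]]; last first.
  by rewrite fE monicE lead_coefDl // lead_coefXn size_polyDl // size_polyXn.
have lt : (size ((F : {poly K}) - 'X^k)%R <= k)%N.
  apply/leq_sizeP => j; rewrite leq_eqVlt coefB coefXn => /predU1P[<-|kj].
    by move/monicP: mF; rewrite /lead_coef sF eqxx /= => ->; rewrite subrr.
  by rewrite nth_default ?sF // gtn_eqF // subr0.
exists (npolyp k ((F : {poly K}) - 'X^k)) => //; apply/val_inj/esym.
by rewrite [LHS]fE npolypK // addrC subrK.
Qed.

Lemma sum_monic_size (K : finFieldType) (m : nat) (u : nat -> rat) :
  \sum_(F : {poly_m.+1 K} | (F : {poly K}) \is monic) u (size (F : {poly K})).-1
  = \sum_(k < m.+1) #|K|%:R ^+ k * u k.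
Proof.
rewrite (partition_big
  (fun F : {poly_m.+1 K} => inord (size (F : {poly K})).-1 : 'I_m.+1) xpredT) //=.
apply: eq_bigr => k _; rewrite -natrX -(card_monic_size K (ltn_ord k)).
rewrite mulr_natl -sumr_const.
have cond (F : {poly_m.+1 K}) :
    ((F : {poly K}) \is monic) && (inord (size (F : {poly K})).-1 == k)
    = (F \in [set F : {poly_m.+1 K} | ((F : {poly K}) \is monic)
              && (size (F : {poly K}) == k.+1)]).
  rewrite inE; apply: andb_id2l => mF.
  have sF : (size (F : {poly K}) <= m.+1)%N := size_npoly F.
  have sF0 : (0 < size (F : {poly K}))%N by rewrite size_poly_gt0 monic_neq0.
  rewrite -val_eqE /= inordK; last by rewrite prednK.
  by rewrite -eqSS prednK.
rewrite (eq_bigl _ _ cond); apply: eq_bigr => F.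
by rewrite inE => /andP[_ /eqP ->].
Qed.

(** Each [y] is charged to some [x] with [g x = v y], and injectivity of [v] charges each [x] at
    most once. This turns the existence of decompositions into an inequality of sums. *)
Lemma ler_sum_cover (X Y : finType) (Z : eqType) (P : pred X) (Q : pred Y)
    (v : Y -> Z) (g : X -> Z) (f : Z -> rat) :
  injective v -> (forall t, 0 <= f t) ->
  (forall y, Q y -> exists2 x, P x & v y = g x) ->
  \sum_(y | Q y) f (v y) <= \sum_(x | P x) f (g x).
Proof.
move=> v_inj f0 cover.
apply: (@le_trans _ _ (\sum_(y | Q y) \sum_(x | P x) (v y == g x)%:R * f (g x))).
  apply: ler_sum => y /cover[x Px vx].
  rewrite (bigD1 x) //= vx eqxx mul1r lerDl.
  by apply: sumr_ge0 => x' _; rewrite mulr_ge0 ?ler0n.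
rewrite exchange_big; apply: ler_sum => x _ /=.
rewrite -mulr_suml -[leRHS]mul1r ler_wpM2r //.
have [y /andP[Qy /eqP vy]|none] := pickP [pred y | Q y & v y == g x].
  rewrite (bigD1 y) //= vy eqxx big1 ?addr0 // => y' /andP[_ ne].
  by rewrite -vy (inj_eq v_inj) (negbTE ne).
rewrite big1 // => y Qy.
by have := none y; rewrite inE Qy /= => ->.
Qed.

(** * Squarefree polynomials of degree at most [z] and the lower bound for S *)

Section PrimesOfBoundedDegree.
Variables (K : finFieldType) (z : nat).

Definition small_prime := {P : {poly_z.+1 K} |
  ((P : {poly K}) \is monic) && irreducibleb (P : {poly K})}.

Definition small_prime_val (i : small_prime) : {poly K} := val (val i).
Local Notation p := small_prime_val.

Lemma small_prime_monic i : p i \is monic.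
Proof. by case/andP: (valP i). Qed.

Lemma small_prime_irreducible i : irreducible_poly (p i).
Proof. by apply/irreducibleP; case/andP: (valP i). Qed.

Lemma small_prime_coprime i j : i != j -> coprimep (p i) (p j).
Proof.
move=> ij; have irr := small_prime_irreducible.
rewrite irreducible_poly_coprime //; apply: contraNN ij => ij.
have si : size (p i) != 1 by rewrite gtn_eqF // (irr i).1.
have := (irr j).2 _ si ij.
by rewrite eqp_monic ?small_prime_monic // => /eqP /val_inj /val_inj ->.
Qed.

Lemma small_prime_exists (P : {poly K}) :
  P \is monic -> irreducible_poly P -> (size P <= z.+1)%N ->
  exists i, p i = P.
Proof.
move=> mP iP sP; have eP : npolyp z.+1 P = P :> {poly K} by rewrite npolypK.
have H : ((npolyp z.+1 P : {poly K}) \is monic)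
    && irreducibleb (npolyp z.+1 P : {poly K}).
  by rewrite eP mP; apply/irreducibleP.
by exists (Sub (npolyp z.+1 P) H).
Qed.

(** Induction on the size, splitting off one prime [P]: if [P] already occurs in [T], the resulting
    square moves into [B]; otherwise [P] joins [T]. *)
Lemma monic_square_decomposition (F : {poly K}) :
  F \is monic -> (size F <= z.+1)%N ->
  exists B : {poly K}, exists2 T : {set small_prime},
    B \is monic & F = B ^+ 2 * \prod_(i in T) p i.
Proof.
have [n] := ubnP (size F); elim: n F => // n IH F /ltnSE leF mF sF.
have [F1|F1] := leqP (size F) 1.
  exists 1, set0; first exact: monic1.
  rewrite big_set0 expr1n mulr1.
  have c : F = (F`_0)%:P by apply: size1_polyC.
  by move/monicP: mF; rewrite {1}c lead_coefC => e; rewrite c e.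
have [P [mP iP PF]] := exists_monic_irreducible_divisor F1.
have F0 := monic_neq0 mF; have P0 := monic_neq0 mP.
have [i pi] := small_prime_exists mP iP (leq_trans (dvdp_leq F0 PF) sF).
have eF : F = P * (F %/ P) by rewrite mulrC divpK.
have mFP : F %/ P \is monic by rewrite -(monicMl _ mP) -eF.
have sFP : (size (F %/ P)%R < size F)%N.
  have sP : (1 < size P)%N := iP.1.
  have sQ : (0 < size (F %/ P)%R)%N by rewrite size_poly_gt0 monic_neq0.
  have -> : size F = ((size P).-1 + (size (F %/ P)%R).-1).+1.
    by rewrite {1}eF size_mul_succ ?monic_neq0.
  by move: sP sQ; lia.
have [||B [T mB eB]] := IH _ _ mFP.
- exact: leq_trans sFP leF.
- exact: leq_trans (ltnW sFP) sF.
have [iT|iT] := boolP (i \in T).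
  exists (B * P), (T :\ i); first by rewrite monicMl.
  by rewrite eF eB (big_setD1 i) //= pi; ring.
exists B, (i |: T) => //.
by rewrite eF eB (big_setU1 _ iT) /= pi; ring.
Qed.

Definition small_prime_sets : {set {set small_prime}} :=
  [set T : {set small_prime} | \sum_(i in T) (size (p i)).-1 <= z]%N.

Lemma size_small_prime_prod (T : {set small_prime}) :
  size (\prod_(i in T) p i) = (\sum_(i in T) (size (p i)).-1).+1.
Proof.
suff [] : size (\prod_(i in T) p i) = (\sum_(i in T) (size (p i)).-1).+1
  /\ \prod_(i in T) p i != 0 by [].
apply: (big_ind2 (fun (u : {poly K}) (v : nat) => size u = v.+1 /\ u != 0)).
- by rewrite size_poly1 oner_neq0.
- move=> u d v e [su u0] [sv v0]; split; last by rewrite mulf_neq0.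
  by rewrite size_mul_succ // su sv.
- by move=> i _; rewrite -polySpred; have := monic_neq0 (small_prime_monic i).
Qed.

(* Expanding each monic [F] of degree at most [z] as [B ^+ 2] times a product
   over a set in [small_prime_sets] gives
   [z + 1 = \sum_F 1 / |F| <= (\sum_B 1 / |B| ^+ 2) * \sum_T 1 / |T|]. *)
Lemma small_prime_sets_sum_ge :
  z.+1%:R * (1 - #|K|%:R^-1)
  <= \sum_(T in small_prime_sets) (pnorm (\prod_(i in T) p i))^-1.
Proof.
set q : rat := #|K|%:R; set S := \sum_(T in _) _.
have q_gt1 : 1 < q by rewrite ltr1n card_finNzRing_gt1.
have q0 : q != 0 by rewrite gt_eqF // (lt_trans ltr01).
have S_ge0 : 0 <= S by apply: sumr_ge0 => T _; rewrite invr_ge0 ltW ?pnorm_gt0.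
pose W := \sum_(B : {poly_z.+1 K} | (B : {poly K}) \is monic)
  (pnorm (B : {poly K}) ^+ 2)^-1.
have geZ : z.+1%:R <= W * S.
  have -> : z.+1%:R = \sum_(F : {poly_z.+1 K} | (F : {poly K}) \is monic)
      (pnorm (F : {poly K}))^-1.
    rewrite (sum_monic_size K z (fun k => (q ^+ k)^-1)).
    rewrite (eq_bigr (fun=> 1)) => [|k _]; last by rewrite divff ?expf_neq0.
    by rewrite sumr_const card_ord.
  pose g (x : {poly_z.+1 K} * {set small_prime}) :=
    (x.1 : {poly K}) ^+ 2 * \prod_(i in x.2) p i.
  have -> : W * S = \sum_(x : {poly_z.+1 K} * {set small_prime} |
      ((x.1 : {poly K}) \is monic) && (x.2 \in small_prime_sets))
      (pnorm (g x))^-1.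
    rewrite /W /S big_distrlr /= pair_big /=; apply: eq_bigr => [[B T]] /=.
    case/andP => mB _; rewrite /g /= -invfM; congr (_^-1).
    have B0 := monic_neq0 mB.
    rewrite pnormM ?expf_neq0 // ?expr2 ?pnormM //.
    by apply/monic_neq0/monic_prod => i _; apply: small_prime_monic.
  apply: (@ler_sum_cover _ _ _ _ _ val g (fun F : {poly K} => (pnorm F)^-1)).
  - exact: val_inj.
  - by move=> t; rewrite invr_ge0 ltW ?pnorm_gt0.
  move=> F mF.
  have sF : (size (F : {poly K}) <= z.+1)%N := size_npoly F.
  have [B [T mB eF]] := monic_square_decomposition mF sF.
  have B0 := monic_neq0 mB.
  have T0 : \prod_(i in T) p i != 0.
    by apply/monic_neq0/monic_prod => i _; apply: small_prime_monic.
  (* Comparing degrees in [F = B ^+ 2 * ...] puts both [B] and [T] in the ranges of summation. *)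
  have sBT : (2 * (size B).-1 + \sum_(i in T) (size (p i)).-1 <= z)%N.
    move: sF; rewrite eF size_mul_succ ?expf_neq0 // size_small_prime_prod.
    by rewrite expr2 size_mul_succ //= mul2n addnn.
  have sB : (size B <= z.+1)%N by move: sBT (polySpred B0); lia.
  exists (npolyp z.+1 B, T); last by rewrite /g /= npolypK.
  by rewrite /= npolypK // mB inE; move: sBT; lia.
(* The q^k monic [B] of degree k contribute q^(-2k) each, so [W] is a truncated geometric series and
   the left side is 1 - q^(-(z+1)). *)
have leW : W * (1 - q^-1) <= 1.
  have -> : W = \sum_(k < z.+1) q^-1 ^+ k.
    rewrite [LHS](sum_monic_size K z (fun k => ((q ^+ k) ^+ 2)^-1)).
    apply: eq_bigr => k _; rewrite exprVn -/q.
    have : q ^+ k != 0 by rewrite expf_neq0.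
    by move: (q ^+ k) => x x0; field.
  rewrite mulrC -opprB mulNr -subrX1 opprB gerBl exprn_ge0 //.
  by rewrite invr_ge0 ltW // (lt_trans ltr01).
have u_gt0 : 0 <= 1 - q^-1 by rewrite subr_ge0 invf_le1 ?ltW // (lt_trans ltr01).
apply: le_trans (ler_wpM2r u_gt0 geZ) _.
by rewrite mulrAC -[leRHS]mul1r ler_wpM2r.
Qed.

End PrimesOfBoundedDegree.

(** * The sieve applied to the interval of length q^(h+1) around [A] *)

Theorem lemma2p7 (q : nat) (K : finFieldType) (hq : #|K| = q)
    (N : nat) (hN : (1 <= N)%N)
    (A : {poly K}) (hA : monic_of_degree N A)
    (h z : nat) (hh : (h <= N - 1)%N)
    (hz1 : (1 <= z)%N) (hz : (z%:R : rat) <= h.+1%:R / 2%:R) :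
  (#|[set F : {poly_N.+1 K} |
       [&& monic_of_degree N (F : {poly K}),
           (size ((F : {poly K}) - A)%R <= h.+1)%N
         & (z < Pminus (F : {poly K}))%N]]|%:R : rat)
  <= q%:R ^+ h.+1 / (z%:R * (1 - q%:R^-1)).
Proof.
have q_gt1 : (1 < q)%N by rewrite -hq card_finNzRing_gt1.
have z2h : (2 * z <= h.+1)%N.
  by move: hz; rewrite ler_pdivlMr ?ltr0n // -natrM ler_nat mulnC.
have u_gt0 : 0 < 1 - q%:R^-1 :> rat.
  by rewrite subr_gt0 invf_lt1 ?ltr1n // ltr0n ltnW.
set R := [set F | _].
pose p := @small_prime_val K z.
pose R' := [set G : {poly_h.+1 K} |
  [forall i, ~~ (p i %| A + (G : {poly K}))%R]].
(* Translation by [-A] injects [R] into [R']: a prime of degree at most [z] dividing [F] would force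
   [Pminus F <= z]. *)
have RR' : (#|R| <= #|R'|)%N.
  pose f (F : {poly_N.+1 K}) : {poly_h.+1 K} := npolyp h.+1 ((F : {poly K}) - A).
  have fE F : F \in R -> f F = (F : {poly K}) - A :> {poly K}.
    by rewrite inE => /and3P[_ sF _]; rewrite npolypK.
  have f_inj : {in R &, injective f}.
    move=> F1 F2 R1 R2 /(congr1 (fun G : {poly_h.+1 K} => (G : {poly K}))).
    by rewrite !fE // => /addIr /val_inj.
  rewrite -(card_in_imset f_inj); apply/subset_leq_card/subsetP => _ /imsetP[F FR ->].
  rewrite inE; apply/forallP => i; rewrite fE // addrC subrK.
  move: FR; rewrite inE => /and3P[/andP[mF _] _ zF]; apply/negP => pF.
  have lePi := Pminus_le (monic_neq0 mF) (small_prime_monic i)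
    (small_prime_irreducible i) pF.
  have ziP : ((size (p i)).-1 <= z)%N.
    by rewrite -subn1 leq_subLR add1n; apply: size_npoly.
  by have := leq_trans (leq_trans zF lePi) ziP; rewrite ltnn.
have sieve := @selberg_upper_bound K _ p A h.+1 (small_prime_sets K z)
  (@small_prime_monic K z) (@small_prime_coprime K z).
have S_ge := small_prime_sets_sum_ge K z.
rewrite ler_pdivlMr ?mulr_gt0 ?ltr0n // -hq.
apply: le_trans (sieve _); last first.
  (* The primes in [T1 :|: T2] have total degree at most 2z, which is at most h + 1. *)
  move=> T1 T2; rewrite !inE => s1 s2; apply: leq_trans z2h.
  rewrite mul2n -addnn; apply: leq_trans (leq_add s1 s2).
  rewrite big_mkcond [X in (_ <= X + _)%N]big_mkcond.
  rewrite [X in (_ <= _ + X)%N]big_mkcond -big_split /=.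
  apply: leq_sum => i _; rewrite inE.
  by case: (i \in T1); case: (i \in T2); rewrite /= ?leq_addr ?leq_addl.
apply: ler_pM; rewrite ?ler0n ?ler_nat //.
  by rewrite mulr_ge0 ?ler0n // hq ltW.
(* The lower bound for S has z + 1 where the theorem asks only for z. *)
by apply: le_trans S_ge; rewrite hq ler_wpM2r ?ler_nat // ltW.
Qed.
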